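(* Let $(N,M,\boldsymbol q)$ be a setting and let $\varphi$ be a strategyproof mechanism such that for some agent $i\in N$, some preference profile $(P_i,P_{-i})\in\mathcal P^N$, and some misreport $P_i'\in\mathcal P$ with $P_i'\ne P_i$, we have $\varphi_i(P_i,P_{-i})=\varphi_i(P_i',P_{-i})$. Then there exists an upper invariant mechanism $\psi$ such that for every $\beta\in(0,1]$ and every $r\in(0,1]$, the hybrid $h^\beta=(1-\beta)\varphi+\beta\psi$ is not $r$-partially strategyproof.
   Context: A setting $(N,M,\boldsymbol q)$ consists of a finite set $N$ of $n$ agents, a finite set $M$ of $m$ objects, and a vector $\boldsymbol q=(q_j)_{j\in M}$ of capacities (positive integers; there are $q_j$ units of object $j$) with $n\le\sum_{j\in M}q_j$. $\mathcal P$ is the set of strict preference orders (linear orders) over $M$; $P:a\succ b$ means that $a$ is strictly preferred to $b$ under $P$. A preference profile is an element $(P_i,P_{-i})\in\mathcal P^N$, where $P_{-i}$ are the orders of all agents except $i$. A utility function $u:M\to\mathbb R^+$ is consistent with $P$ if $u(a)>u(b)$ whenever $P:a\succ b$; $U_P$ is the set of utility functions consistent with $P$. An assignment is an $N\times M$ matrix $x$ with $x_{i,j}\in[0,1]$, $\sum_{j\in M}x_{i,j}=1$ for all $i\in N$, and $\sum_{i\in N}x_{i,j}\le q_j$ for all $j\in M$; $\Delta(X)$ is the set of assignments. A mechanism is a map $\varphi:\mathcal P^N\to\Delta(X)$; $\varphi_i(P_i,P_{-i})$ is the row of agent $i$, with entries $\varphi_{i,j}(P_i,P_{-i})$. Hybrids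 are pointwise convex combinations. Write $\langle u,v\rangle=\sum_{j\in M}u(j)v_j$. $\varphi$ is strategyproof if $\langle u_i,\varphi_i(P_i,P_{-i})-\varphi_i(P_i',P_{-i})\rangle\ge0$ for all $i\in N$, $(P_i,P_{-i})\in\mathcal P^N$, $P_i'\in\mathcal P$, $u_i\in U_{P_i}$. For $r\in[0,1]$, $u\in U_P$ satisfies URBI($r$) if for all $a,b\in M$ with $P:a\succ b$ we have $r\,(u(a)-\min_{j\in M}u(j))\ge u(b)-\min_{j\in M}u(j)$. A mechanism is $r$-partially strategyproof if the inequality in the definition of strategyproofness holds for all $i$, $(P_i,P_{-i})$, $P_i'$, and all $u_i\in U_{P_i}$ satisfying URBI($r$). The neighborhood $N_P$ of $P\in\mathcal P$ is the set of orders obtained from $P$ by swapping two objects that are adjacent in $P$. A mechanism $\psi$ is upper invariant if for all $i$, $(P_i,P_{-i})$, and $P_i'\in N_{P_i}$ with $P_i:a\succ b$ and $P_i':b\succ a$, we have $\psi_{i,j}(P_i,P_{-i})=\psi_{i,j}(P_i',P_{-i})$ for all $j\in M$ with $P_i:j\succ a$. *)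

(* Defs.v *)
From HB Require Import structures.
From mathcomp Require Import all_boot all_order all_algebra all_fingroup.
From mathcomp Require Import reals.

Set Implicit Arguments.
Unset Strict Implicit.
Unset Printing Implicit Defensive.

Import Order.TTheory GRing.Theory Num.Theory.
Local Open Scope ring_scope.

Section Preferences.
Variable M : finType.

Definition strict_linear (S : {set M * M}) : bool :=
  [&& [forall a, (a, a) \notin S],
      [forall a, forall b, forall c,
         ((a, b) \in S) ==> ((b, c) \in S) ==> ((a, c) \in S)]
    & [forall a, forall b, (a != b) ==> ((a, b) \in S) || ((b, a) \in S)]].

(* A strict order is stored as the set of pairs (a, b) with a preferred to b,
   so that Leibniz equality is equality of orders. *)
Record pref := Pref { pref_set : {set M * M}; _ : strict_linear pref_set }.

HB.instance Definition _ := [isSub for pref_set].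
HB.instance Definition _ := [Finite of pref by <:].

Definition prefers (P : pref) : rel M := fun a b => (a, b) \in pref_set P.

Definition adjacent (P : pref) (a b : M) : Prop :=
  prefers P a b /\ (forall c : M, ~ (prefers P a c /\ prefers P c b)).

Definition neighbor (P P' : pref) : Prop :=
  exists a b : M, adjacent P a b /\
    (forall x y : M, prefers P' x y = prefers P (tperm a b x) (tperm a b y)).

End Preferences.

Section Mechanisms.
Variables (R : realType) (N M : finType).

Definition profile := {ffun N -> pref M}.

(* The profile (Q, P_{-i}). *)
Definition report (P : profile) (i : N) (Q : pref M) : profile :=
  finfun [eta P with i |-> Q].

Definition is_assignment (q : M -> nat) (x : N -> M -> R) : Prop :=
  [/\ forall i j, 0 <= x i j <= 1,
      forall i, \sum_(j : M) x i j = 1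
    & forall j, \sum_(i : N) x i j <= (q j)%:R].

Definition is_mechanism (q : M -> nat) (phi : profile -> N -> M -> R) : Prop :=
  forall P : profile, is_assignment q (phi P).

(* Utilities take values in [0, +oo[. *)
Definition consistent (P : pref M) (u : M -> R) : Prop :=
  (forall a, 0 <= u a) /\ (forall a b, prefers P a b -> u b < u a).

Definition inner (u v : M -> R) : R := \sum_(j : M) u j * v j.

Definition no_gain (phi : profile -> N -> M -> R) (P : profile) (i : N)
    (Q : pref M) (u : M -> R) : Prop :=
  0 <= inner u (fun j => phi P i j - phi (report P i Q) i j).

Definition strategyproof (phi : profile -> N -> M -> R) : Prop :=
  forall (i : N) (P : profile) (Q : pref M) (u : M -> R),
    consistent (P i) u -> no_gain phi P i Q u.

(* Since the iterated minimum ranges over all of M, its initial value [u a]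
   only serves to avoid assuming a default object. *)
Definition URBI (r : R) (P : pref M) (u : M -> R) : Prop :=
  forall a b : M, prefers P a b ->
    let umin := \big[Num.min/u a]_(j : M) u j in
    u b - umin <= r * (u a - umin).

Definition partially_strategyproof (r : R) (phi : profile -> N -> M -> R) :
    Prop :=
  forall (i : N) (P : profile) (Q : pref M) (u : M -> R),
    consistent (P i) u -> URBI r (P i) u -> no_gain phi P i Q u.

Definition upper_invariant (psi : profile -> N -> M -> R) : Prop :=
  forall (i : N) (P : profile) (Q : pref M) (a b : M),
    neighbor (P i) Q -> prefers (P i) a b -> prefers Q b a ->
    forall j : M, prefers (P i) j a -> psi P i j = psi (report P i Q) i j.

Definition hybrid (beta : R) (phi psi : profile -> N -> M -> R) :
    profile -> N -> M -> R :=
  fun P i j => (1 - beta) * phi P i j + beta * psi P i j.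

End Mechanisms.

(* Main.v *)
(* Swapping an agent's slot with a slot of [a] shows that any single agent can
   be given any single object.  Pick [a], [b] ranked in this order by [P_i] and
   in the opposite order by [P_i'].  Let [psi] look only at agent [i]'s ranking
   of these two objects and give agent [i] the one ranked lower.  A swap changes
   the outcome only if it exchanges [a] and [b], so [psi] is upper invariant.
   Reporting [P_i'] does not change the [phi] part of the hybrid and replaces
   [b] by [a] in the [psi] part, which is a strict gain for every consistent
   utility; and for every [r > 0] a geometrically decaying utility satisfies
   URBI([r]). *)
Require Import Defs.
From HB Require Import structures.
From mathcomp Require Import all_boot all_order all_algebra all_fingroup.
From mathcomp Require Import reals.
Import Order.TTheory GRing.Theory Num.Theory.
Local Open Scope ring_scope.

Set Implicit Arguments.
Unset Strict Implicit.
Unset Printing Implicit Defensive.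

Section PreferenceOrders.
Variable M : finType.
Implicit Types (P Q : pref M) (a b c : M).

Lemma prefers_irr P a : prefers P a a = false.
Proof.
case: P => S h; rewrite /prefers /=; case/and3P: (h) => /forallP/(_ a).
by move=> /negbTE.
Qed.

Lemma prefers_trans P a b c : prefers P a b -> prefers P b c -> prefers P a c.
Proof.
case: P => S h; rewrite /prefers /=; case/and3P: (h) => _ + _.
by move=> /forallP/(_ a)/forallP/(_ b)/forallP/(_ c)/implyP k /k /implyP.
Qed.

Lemma prefers_total P a b : a != b -> prefers P a b || prefers P b a.
Proof.
case: P => S h; rewrite /prefers /=; case/and3P: (h) => _ _.
by move=> /forallP/(_ a)/forallP/(_ b)/implyP.
Qed.

Lemma prefers_neq P a b : prefers P a b -> a != b.
Proof. by apply: contraTneq => ->; rewrite prefers_irr. Qed.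

Lemma prefers_asym P a b : prefers P a b -> prefers P b a = false.
Proof. by move=> ab; apply/negP => /(prefers_trans ab); rewrite prefers_irr. Qed.

(** Inclusion suffices by totality: a pair of [Q] missing from [P] would be reversed in [P], hence
    also in [Q], against asymmetry. *)
Lemma prefers_sub_eq P Q :
  (forall a b, prefers P a b -> prefers Q a b) -> P = Q.
Proof.
move=> PQ; apply: val_inj; apply/setP => -[a b].
apply/idP/idP; first exact: PQ.
change (prefers Q a b -> prefers P a b) => Qab.
have /orP[//|/PQ] := prefers_total P (prefers_neq Qab).
by rewrite prefers_asym.
Qed.

Lemma neq_reversal P Q : Q <> P -> exists a b, prefers P a b /\ prefers Q b a.
Proof.
move=> QP; have [/existsP[a /existsP[b /andP[Pab nQab]]]|none] :=
  boolP [exists a, exists b, prefers P a b && ~~ prefers Q a b].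
  exists a, b; split=> //.
  by have := prefers_total Q (prefers_neq Pab); rewrite (negbTE nQab).
case: QP; apply/esym/prefers_sub_eq => a b Pab; apply: contraNT none => nQab.
by apply/existsP; exists a; apply/existsP; exists b; rewrite Pab.
Qed.

(** Any reversed pair other than the swapped one would either create a cycle in [P] or put a third
    object strictly between the two adjacent ones. *)
Lemma neighbor_reversal P Q : neighbor P Q ->
  exists a b, forall x y, prefers P x y -> prefers Q y x -> x = a /\ y = b.
Proof.
case=> a [b [[Pab adj] PQ]]; exists a, b => x y Pxy; rewrite PQ.
case: (tpermP a b y) Pxy => [->|->|_ _]; case: tpermP => [->|->|_ _] //.
- by rewrite prefers_irr.
- by move=> Pba; rewrite prefers_asym in Pab.
- by move=> Pxa Pbx; rewrite (prefers_asym (prefers_trans Pbx Pxa)) in Pab.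
- by rewrite prefers_irr.
- by move=> Pxb Pax; case: (adj x).
- by move=> Pay Pyb; case: (adj y).
- by move=> Pby Pya; rewrite (prefers_asym (prefers_trans Pby Pya)) in Pab.
- by move=> Pxy; rewrite prefers_asym.
Qed.

Definition rank P a := #|[set c | prefers P c a]|.

Lemma rank_lt P a b : prefers P a b -> (rank P a < rank P b)%N.
Proof.
move=> Pab; apply/proper_card/properP; split.
  by apply/subsetP => c; rewrite !inE => /prefers_trans; apply.
by exists a; rewrite !inE ?prefers_irr.
Qed.

Lemma exists_URBI (R : realType) (r : R) P : 0 < r <= 1 ->
  exists u, consistent P u /\ URBI r P u.
Proof.
(* Halving keeps the ratio strictly below 1 even for [r = 1], so that the powers of [s] decrease
   strictly. *)
move=> /andP[r0 r1]; pose s := r / 2.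
have s0 : 0 < s by rewrite divr_gt0.
have sr : s < r by rewrite ltr_pdivrMr // mulr_natr mulr2n ltrDl.
have s1 : s < 1 := lt_le_trans sr r1.
pose u a := s ^+ rank P a.
have u0 a : 0 < u a by rewrite exprn_gt0.
have us a b : prefers P a b -> u b <= s * u a.
  move=> /rank_lt ab; rewrite -exprS; apply: ler_wiXn2l => //; exact: ltW.
exists u; split.
  split=> [a|a b /us ab]; first exact: ltW.
  by apply: le_lt_trans ab _; rewrite gtr_pMl.
move=> a b Pab /=; set m := \big[_/_]_(j : M) _.
have m0 : 0 <= m.
  apply: (big_ind (fun x => 0 <= x)) => [|x y x0 y0|j _]; first exact: ltW.
    by rewrite le_min x0.
  exact: ltW.
(* Since [m] is nonnegative and [r <= 1], we have [r * m <= m]; it remains to compare [u b] with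
   [r * u a]. *)
rewrite mulrBr; apply: lerB; last by rewrite ler_piMl.
by apply: le_trans (us _ _ Pab) _; rewrite ler_pM2r // ltW.
Qed.

End PreferenceOrders.

Lemma exists_assign_at (N M : finType) (q : M -> nat) (i : N) (a : M) :
  (0 < q a)%N -> (#|N| <= \sum_(j : M) q j)%N ->
  exists f : N -> M, f i = a /\ (forall j, #|[set k | f k == j]| <= q j)%N.
Proof.
(* A slot is one unit of one object, so any injection of agents into slots respects the
   capacities. *)
move=> qa hcap; pose slot := {j : M & 'I_(q j)}.
have hslot : (#|N| <= #|{: slot}|)%N.
  rewrite card_tagged sumnE big_map big_enum /=.
  by under eq_bigr do rewrite card_ord.
pose g k : slot := enum_val (widen_ord hslot (enum_rank k)).
have g_inj : injective g.
  by move=> x y /enum_val_inj /(congr1 val) /= /val_inj /enum_rank_inj.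
pose sa : slot := Tagged (fun j => 'I_(q j)) (Ordinal qa).
pose h k := tperm (g i) sa (g k).
have h_inj : injective h by move=> x y /perm_inj /g_inj.
exists (fun k => tag (h k)); split=> [|j]; first by rewrite /h tpermL.
(* The agents receiving [j] are counted by their slots, all of which lie among the [q j] slots with
   tag [j]. *)
rewrite -(card_imset _ h_inj) -[leqRHS]card_ord.
rewrite -(card_imset predT (f := @Tagged _ j (fun j => 'I_(q j)))); last first.
  by move=> x y /eqP; rewrite eq_Tagged => /eqP.
apply/subset_leq_card/subsetP => t /imsetP[k]; rewrite inE => /eqP kj ->.
by move: kj; case: (h k) => j' x /= kj; subst j'; apply: imset_f.
Qed.

Lemma is_assignment_deterministic (R : realType) (N M : finType)
    (q : M -> nat) (f : N -> M) :
  (forall j, #|[set k | f k == j]| <= q j)%N ->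
  is_assignment q (fun k j => (f k == j)%:R : R).
Proof.
move=> fq; split=> [k j|k|j].
- by rewrite ler0n lern1; case: eqP.
- rewrite (bigD1 (f k)) //= eqxx big1 ?addr0 // => j.
  by rewrite eq_sym => /negbTE ->.
- rewrite -natr_sum ler_nat; apply: leq_trans (fq j).
  by rewrite -sum1dep_card [leqRHS]big_mkcond /=; apply: leq_sum => k _; case: eqP.
Qed.

Lemma inner_indicator (R : realType) (M : finType) (u : M -> R) (a : M) :
  inner u (fun j => (a == j)%:R) = u a.
Proof.
rewrite /inner (bigD1 a) //= eqxx mulr1 big1 ?addr0 // => j.
by rewrite eq_sym => /negbTE ->; rewrite mulr0.
Qed.

Theorem proposition3 (R : realType) (N M : finType) (q : M -> nat)
    (hq : forall j : M, (0 < q j)%N)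
    (hcap : (#|N| <= \sum_(j : M) q j)%N)
    (phi : profile N M -> N -> M -> R)
    (hphi : is_mechanism q phi)
    (hsp : strategyproof phi)
    (hvar : exists (i : N) (P : profile N M) (Q : pref M),
        Q <> P i /\ (forall j : M, phi P i j = phi (report P i Q) i j)) :
  exists psi : profile N M -> N -> M -> R,
    [/\ is_mechanism q psi,
        upper_invariant psi
      & forall beta r : R, 0 < beta <= 1 -> 0 < r <= 1 ->
          ~ partially_strategyproof r (hybrid beta phi psi)].
Proof.
case: hvar => i [P [Q [QP phiE]]].
have [a [b [Pab Qba]]] := neq_reversal QP.
have [fa [fai faq]] := exists_assign_at i (hq a) hcap.
have [fb [fbi fbq]] := exists_assign_at i (hq b) hcap.
pose f (P' : profile N M) := if prefers (P' i) a b then fb else fa.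
exists (fun P' k j => (f P' k == j)%:R); split.
- by move=> P'; apply: is_assignment_deterministic; rewrite /f; case: ifP.
- move=> k P' Q' c d nPQ Pcd Qdc j Pjc; rewrite /f ffunE /=.
  (* A report by another agent leaves the ranking of agent [i], and hence [f], unchanged. *)
  case: (eqVneq i k) => // ik; rewrite -ik {ik} in nPQ Pcd Qdc Pjc *.
  have [x [y rev]] := neighbor_reversal nPQ.
  have [cx dy] := rev _ _ Pcd Qdc.
  have jc := prefers_neq Pjc; have jd := prefers_neq (prefers_trans Pjc Pcd).
  have ab := prefers_neq Pab.
  (* If the ranking of [a] and [b] flips, they are [c] and [d] in some order. The row of agent [i]
     then changes only at these two objects, and [j], ranked above both, is neither. *)
  case: ifP => [P'ab|/negbT nP'ab]; case: ifP => [Q'ab|/negbT nQ'ab] //.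
    have /orP[|Q'ba] := prefers_total Q' ab; first by rewrite (negbTE nQ'ab).
    have [ax by_] := rev _ _ P'ab Q'ba.
    rewrite fai fbi ax by_ -cx -dy.
    by rewrite eq_sym (negbTE jd) eq_sym (negbTE jc).
  have /orP[|P'ba] := prefers_total (P' i) ab; first by rewrite (negbTE nP'ab).
  have [bx ay] := rev _ _ P'ba Q'ab.
  rewrite fai fbi ay bx -cx -dy.
  by rewrite eq_sym (negbTE jd) eq_sym (negbTE jc).
- move=> beta r /andP[beta0 _] hr psp.
  have [u [uP uU]] := exists_URBI (P i) hr.
  have := psp i P Q u uP uU; rewrite /no_gain.
  (* The [phi] terms cancel by [phiE]; what remains compares [b], obtained by truth-telling, with
     [a], obtained by reporting [Q]. This is negative because [u b < u a]. *)
  suff -> : inner u (fun j => hybrid beta phi (fun P' k j => (f P' k == j)%:R) P i j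
      - hybrid beta phi (fun P' k j => (f P' k == j)%:R) (report P i Q) i j)
    = beta * (u b - u a).
    by rewrite pmulr_rge0 // subr_ge0 leNgt; case: uP => _ ->.
  rewrite -(inner_indicator u a) -(inner_indicator u b) /inner -sumrB mulr_sumr.
  apply: eq_bigr => j _; rewrite /hybrid -phiE /f ffunE /= eqxx Pab.
  rewrite (prefers_asym Qba) fai fbi opprD addrACA subrr add0r.
  by rewrite -!mulrBr mulrCA.
Qed.
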